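(* Suppose $X$ is an infinite dimensional Banach space whose dual ball is separable in the weak$^*$ topology. Then there is an injective bounded linear operator $T:X\to X$ which is not an automorphism of $X$. In particular, every separable infinite dimensional Banach space and every hereditarily indecomposable (HI) Banach space admits an injective bounded linear operator into itself which is not an automorphism.
   Context: The dual ball of $X$ is the closed unit ball of $X^*$. An automorphism of $X$ is a bounded linear bijection $X\to X$ with bounded inverse. A Banach space is hereditarily indecomposable (HI) if it is infinite dimensional and no closed subspace of it is the topological direct sum of two infinite dimensional closed subspaces. *)

(* Defs.v *)
From HB Require Import structures.
From mathcomp Require Import all_boot all_order all_algebra complex.
From mathcomp Require Import boolp classical_sets functions cardinality reals.
From mathcomp Require Import topology normedtype.

Set Implicit Arguments.
Unset Strict Implicit.
Unset Printing Implicit Defensive.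

Import Order.TTheory GRing.Theory Num.Theory.
Import numFieldNormedType.Exports.

Local Open Scope classical_set_scope.
Local Open Scope ring_scope.

Definition separable_set (T : topologicalType) (A : set T) : Prop :=
  exists D : set T, [/\ countable D, D `<=` A & A `<=` closure D].

Section Operators.
Variable K : numFieldType.

Definition bounded_operator (X Y : normedModType K) (f : X -> Y) : Prop :=
  exists M : K, forall x, `|f x| <= M * `|x|.

Definition automorphism (X : normedModType K) (T : {linear X -> X}) : Prop :=
  bounded_operator T /\
  exists S : {linear X -> X}, [/\ bounded_operator S, cancel T S & cancel S T].

End Operators.

Section Dual.
Variables (K : numFieldType) (X : normedModType K).

(* [{ptws X -> K^o}] carries the topology of pointwise convergence on [X]; the
   topology it induces on the dual space is the weak* topology. *)
Definition dual_space : set {ptws X -> K^o} :=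
  [set f | linear (f : X -> K^o) /\ bounded_operator (f : X -> K^o)].

(* The second condition says that the dual norm
   sup {|f x| : |x| <= 1} is at most 1. *)
Definition dual_ball : set {ptws X -> K^o} :=
  [set f | dual_space f /\ forall x : X, `|x| <= 1 -> `|f x| <= 1].

End Dual.

Section Subspaces.
Variables (K : numFieldType) (X : normedModType K).

Definition closed_subspace (Y : set X) : Prop :=
  submod_closed (mem Y) /\ closed Y.

(* To be used for linear subspaces [Y]. *)
Definition finite_dimensional (Y : set X) : Prop :=
  exists (n : nat) (b : 'I_n -> X), (forall i, Y (b i)) /\
    forall y, Y y -> exists c : 'I_n -> K, y = \sum_(i < n) c i *: b i.

Definition infinite_dimensional (Y : set X) : Prop := ~ finite_dimensional Y.

(* The bound says that the inverse of the addition map Y x W -> Z is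
   continuous, equivalently that the two projections are. *)
Definition topological_direct_sum (Z Y W : set X) : Prop :=
  [/\ Z = [set y + w | y in Y & w in W],
      Y `&` W = [set 0] &
      exists M : K, forall y w, Y y -> W w -> `|y| + `|w| <= M * `|y + w|].

End Subspaces.

Definition hereditarily_indecomposable (K : numFieldType)
    (X : normedModType K) : Prop :=
  infinite_dimensional [set: X] /\
  ~ exists Z Y W : set X,
      [/\ closed_subspace Z, closed_subspace Y, closed_subspace W,
          infinite_dimensional Y /\ infinite_dimensional W &
          topological_direct_sum Z Y W].

(* Main.v *)
Require Import Defs.
From HB Require Import structures.
From mathcomp Require Import all_boot all_order all_algebra complex.
From mathcomp Require Import boolp classical_sets functions cardinality reals.
From mathcomp Require Import topology normedtype.
From mathcomp Require Import ring lra.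

(** A bounded operator with the required properties is an infinite diagonal sum
      T x = \sum_n 2^-n f_n(x) e_n,
    where the e_n are unit vectors and the f_n are functionals of norm at most 1
    that separate the points of X.  Such a T is never an automorphism: finitely
    many functionals on an infinite dimensional space have a common zero of norm
    1, and at a common zero of f_0, ..., f_(n-1) the norm of T x is only of the
    order of 2^-n, so T is not bounded below.  For T to be injective it is enough
    that the e_n are in triangular position with respect to some bounded
    functionals g_n, that is g_m(e_n) = 0 for m < n and g_n(e_n) <> 0: if T x = 0,
    applying g_0, g_1, ... in turn yields f_0(x) = 0, f_1(x) = 0, and so on
    ([operator_of_separating_sequence]).  A triangular system exists in every
    infinite dimensional space ([triangular_system]).

    It remains to find a separating sequence of functionals in each case.
    - If the dual ball is weak* separable, a weak* dense sequence of the dual ball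
      separates points, because the dual ball does.
    - A sequence q_n of vectors has functionals f_n of norm at most 1 with
      |f_n(q_n)| = |q_n|.  For y in the closure of the sequence and z in the common
      kernel of the f_n they give |y| <= |y + z| ([norming_sequence]).  When the
      q_n are dense, z = - y shows that the f_n separate points.
    - If X is hereditarily indecomposable, let Y be the closed span of a triangular
      system; it is separable and infinite dimensional.  With a dense sequence of Y,
      the inequality says that Y and the common kernel W of the f_n form a
      topological direct sum, which is closed because X is complete
      ([norming_direct_sum]).  Hence W has finite dimension.  Functionals norming
      the separable space W, added to the f_n, make a separating sequence.

    The norming functionals come from the Hahn-Banach theorem, proved here through
    minimal sublinear functionals ([hahn_banach]).  The argument depends on the
    scalar field only through the three properties [norming_functionals],
    [has_dense_sequence] and [vanishing_halves], established for the real and for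
    the complex numbers. *)

Set Implicit Arguments.
Unset Strict Implicit.
Unset Printing Implicit Defensive.

Import Order.TTheory GRing.Theory Num.Theory.
Import numFieldNormedType.Exports.

Local Open Scope classical_set_scope.
Local Open Scope ring_scope.
Local Open Scope complex_scope.

(** * Hahn-Banach theorem *)

(** The real scalars act on a vector space over [K] through [iota], so that one
    theorem on real-valued functionals serves real and complex spaces alike. *)
Section Sublinear.
Variables (R : realType) (K : numFieldType) (iota : {rmorphism R -> K}).
Variable V : lmodType K.
Implicit Types (p q : V -> R) (x y : V).

Definition sublinear p :=
  (forall x y, p (x + y) <= p x + p y) /\
  (forall a x, 0 < a -> p (iota a *: x) <= a * p x).

Lemma iotaVK a x : 0 < a -> iota a^-1 *: (iota a *: x) = x.
Proof.
by move=> a0; rewrite scalerA -rmorphM mulVf ?gt_eqF// rmorph1 scale1r.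
Qed.

Lemma sublinearZ p a x : sublinear p -> 0 < a -> p (iota a *: x) = a * p x.
Proof.
move=> [_ pZ] a0; apply/eqP; rewrite eq_le pZ//=.
have := pZ a^-1 (iota a *: x); rewrite invr_gt0 iotaVK// => /(_ a0).
by rewrite mulrC ler_pdivlMr// mulrC.
Qed.

Lemma sublinear0 p : sublinear p -> p 0 = 0.
Proof.
move=> pS; have := @sublinearZ p 2%:R 0 pS (ltr0n _ 2).
by rewrite scaler0 => h; lra.
Qed.

Lemma sublinear_ge p x : sublinear p -> - p (- x) <= p x.
Proof.
by move=> pS; have := pS.1 x (- x); rewrite subrr sublinear0// => h; lra.
Qed.

(** The greatest sublinear functional below [p] whose value at [- y] is at most
    [- p y].  A minimal [p] coincides with all its tilts, and this makes it
    additive. *)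
Definition tilt p y x : R :=
  inf [set p (x + iota t *: y) - t * p y | t in [set t | 0 < t]].

Lemma tilt_le p y x t : sublinear p -> 0 < t ->
  tilt p y x <= p (x + iota t *: y) - t * p y.
Proof.
move=> pS t0; apply: ge_inf; last by exists t.
exists (- p (- x)) => _ [s /= s0 <-].
rewrite -sublinearZ//.
have := pS.1 (x + iota s *: y) (- x).
by rewrite addrAC subrr add0r => h; lra.
Qed.

Lemma tilt_glb p y x m :
  (forall t, 0 < t -> m <= p (x + iota t *: y) - t * p y) -> m <= tilt p y x.
Proof.
move=> h; apply: lb_le_inf.
  by exists (p (x + iota 1 *: y) - 1 * p y), 1 => //=.
by move=> _ [t /= t0 <-]; apply: h.
Qed.

Lemma sublinear_tilt p y : sublinear p -> sublinear (tilt p y).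
Proof.
move=> pS; split=> [x x'|a x a0].
  rewrite -lerBlDr; apply: tilt_glb => t t0.
  rewrite lerBlDr -lerBlDl; apply: tilt_glb => s s0.
  rewrite lerBlDl.
  apply: (le_trans (tilt_le _ _ pS (addr_gt0 t0 s0))).
  have := pS.1 (x + iota t *: y) (x' + iota s *: y).
  by rewrite addrACA -scalerDl -rmorphD => h; lra.
rewrite -ler_pdivrMl//; apply: tilt_glb => t t0.
rewrite ler_pdivrMl//.
apply: (le_trans (tilt_le _ _ pS (mulr_gt0 a0 t0))).
by rewrite rmorphM -scalerA -scalerDr sublinearZ// mulrBr mulrA.
Qed.

Lemma tilt_le_self p y x : sublinear p -> tilt p y x <= p x.
Proof.
move=> pS; apply: (le_trans (tilt_le _ _ pS ltr01)).
by have := pS.1 x (iota 1 *: y); rewrite sublinearZ// => h; lra.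
Qed.

(** Zorn's lemma for the reverse pointwise order: the pointwise infimum of a
    chain of sublinear functionals is again sublinear, subadditivity being the
    point where comparability is used.  The infimum is finite since
    [- p (- x)] bounds from below every sublinear functional under [p]. *)
Lemma minimal_sublinear p : sublinear p ->
  exists q, [/\ sublinear q, forall x, q x <= p x &
    forall q', sublinear q' -> (forall x, q' x <= q x) -> q' = q].
Proof.
move=> pS.
pose T := {q : V -> R | sublinear q /\ forall x, q x <= p x}.
pose le_fun (q q' : T) : bool := `[< forall x, sval q' x <= sval q x >].
have [||||[q [qS qp]] qmin] := @Zorn T le_fun.
- by move=> q; apply/asboolP.
- move=> q r s /asboolP qr /asboolP rs; apply/asboolP => x.
  exact: le_trans (rs x) (qr x).
- move=> [q hq] [r hr] /asboolP /= qr /asboolP /= rq; apply: eq_exist.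
  by apply/funext => x; apply/eqP; rewrite eq_le qr rq.
- move=> A Atot; have [->|/set0P[q0 Aq0]] := eqVneq A set0.
    by exists (exist _ p (conj pS (fun x => lexx _))) => s [].
  pose m x := inf [set sval q x | q in A].
  have m_le (q : T) x : A q -> m x <= sval q x.
    move=> Aq; apply: ge_inf; last by exists q.
    exists (- p (- x)) => _ [[r [rS rp]] _ <-] /=.
    by apply: le_trans (sublinear_ge _ rS); rewrite lerN2.
  have m_glb x c : (forall q : T, A q -> c <= sval q x) -> c <= m x.
    move=> h; apply: lb_le_inf; first by exists (sval q0 x), q0.
    by move=> _ [q Aq <-]; apply: h.
  have mS : sublinear m.
    split=> [x y|a x a0].
      rewrite -lerBlDr; apply: (m_glb) => q Aq.
      rewrite lerBlDr -lerBlDl; apply: (m_glb) => r Ar.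
      rewrite lerBlDl.
      have [/asboolP qr|/asboolP rq] := Atot _ _ Aq Ar.
        apply: (le_trans (m_le _ _ Ar)).
        by apply: (le_trans ((svalP r).1.1 x y)); rewrite lerD2r.
      apply: (le_trans (m_le _ _ Aq)).
      by apply: (le_trans ((svalP q).1.1 x y)); rewrite lerD2l.
    rewrite -ler_pdivrMl//; apply: (m_glb) => q Aq; rewrite ler_pdivrMl//.
    by apply: (le_trans (m_le _ _ Aq)); apply: (svalP q).1.2.
  have mp x : m x <= p x by apply: le_trans (m_le _ x Aq0) _; apply: (svalP q0).2.
  by exists (exist _ m (conj mS mp)) => s As; apply/asboolP => x; apply: (m_le).
exists q; split=> // q' q'S q'q.
have q'p x : q' x <= p x by apply: le_trans (q'q x) (qp x).
by have /(congr1 sval)/= := qmin (exist _ q' (conj q'S q'p))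
  (introT (asboolP _) q'q).
Qed.

(** A minimal sublinear functional is additive, hence real linear.  Taking it
    below the tilt of [p] at [x0] rather than below [p] forces the value at
    [x0], because that tilt is at most [- p x0] at [- x0]. *)
Lemma hahn_banach p x0 : sublinear p ->
  exists q, [/\ {morph q : x y / x + y}, forall a x, q (iota a *: x) = a * q x,
    forall x, q x <= p x & q x0 = p x0].
Proof.
move=> pS; have [q [qS qle qmin]] := minimal_sublinear (sublinear_tilt x0 pS).
have qD : {morph q : x y / x + y}.
  move=> x y; apply/eqP; rewrite eq_le qS.1/=.
  have <- : tilt q y x = q x.
    by rewrite (qmin _ (sublinear_tilt y qS))// => z; apply: tilt_le_self.
  have := tilt_le y x qS ltr01; rewrite rmorph1 scale1r => h; lra.
have qN x : q (- x) = - q x.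
  by have := qD x (- x); rewrite subrr sublinear0// => h; lra.
have qp x : q x <= p x by apply: le_trans (qle x) (tilt_le_self _ _ pS).
exists q; split=> //.
- move=> a x; have [a0|a0|->] := ltrgt0P a.
  + exact: sublinearZ.
  + rewrite -[a]opprK rmorphN scaleNr qN sublinearZ ?oppr_gt0//; ring.
  + by rewrite rmorph0 scale0r mul0r sublinear0.
- apply/eqP; rewrite eq_le qp/=.
  have := le_trans (qle (- x0)) (tilt_le _ _ pS ltr01).
  by rewrite rmorph1 scale1r addNr sublinear0// qN => h; lra.
Qed.

End Sublinear.

(** * Properties of the scalar field *)

Lemma bundle_linear (K : numFieldType) (V W : lmodType K) (f : V -> W) :
  linear f -> exists g : {linear V -> W}, g =1 f.
Proof.
move=> fL; pose H := GRing.isLinear.Build K V W *:%R f fL.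
by exists (HB.pack_for {linear V -> W} f H).
Qed.

Definition norming_functionals (K : numFieldType) :=
  forall (X : normedModType K) (x : X), exists f : {linear X -> K^o},
    (forall y, `|f y| <= `|y|) /\ `|f x| = `|x|.

Definition has_dense_sequence (K : numFieldType) :=
  exists q : nat -> K, forall c e, 0 < e -> exists n, `|c - q n| < e.

Definition vanishing_halves (K : numFieldType) :=
  forall e : K, 0 < e -> exists n, 2^-1 ^+ n < e.

Lemma real_norming (R : realType) : norming_functionals R.
Proof.
move=> X x; pose p (y : X) : R := `|y|.
have pS : sublinear (idfun : {rmorphism R -> R}) p.
  split=> [y z|a y a0]; first exact: ler_normD.
  by rewrite /p normrZ gtr0_norm.
have [q [qD qZ qp qx]] := hahn_banach x pS.
have [f fE] : exists f : {linear X -> R^o}, f =1 q.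
  by apply: (@bundle_linear _ X R^o) => a y z; rewrite qD qZ.
have f_le y : `|f y| <= `|y|.
  rewrite fE ler_norml qp andbT.
  by have := qp (- y); rewrite /p normrN -scaleN1r (qZ (-1)) => h; lra.
exists f; split=> //; apply/eqP; rewrite eq_le f_le/=.
by rewrite -[`|x|]/(p x) -qx -fE ler_norm.
Qed.

(** The usual complexification: a real linear functional [q] is the real part of
    [f y = q y - i q (i y)].  The bound on [f] follows from the bound on [q] by
    rotating [y] so that [f y] becomes a nonnegative real number. *)
Lemma complex_norming (R : realType) : norming_functionals R[i].
Proof.
move=> X x; pose p (y : X) : R := complex.Re `|y|.
have pE (y : X) : (p y)%:C = `|y| by apply/RRe_real/normr_real.
pose io : {rmorphism R -> R[i]} := real_complex R.
have pS : sublinear io p.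
  split=> [y z|a y a0]; first by rewrite -lecR rmorphD /= !pE ler_normD.
  by rewrite -lecR rmorphM /= !pE normrZ gtr0_norm// ltcR.
have [q [qD qZ qp qx]] := hahn_banach x pS.
have qZc (a b : R) y : q ((a +i* b) *: y) = a * q y + b * q ('i *: y).
  rewrite [_ +i* _]complexE/= scalerDl qD qZ; congr (_ + _).
  by rewrite mulrC -scalerA qZ.
have [f fE] : exists f : {linear X -> R[i]^o}, f =1 fun y => q y -i* q ('i *: y).
  apply: (@bundle_linear _ X R[i]^o) => -[a b] y z /=.
  rewrite scalerDr !qD scalerA qZc.
  have -> : 'i%C * (a +i* b) = (- b) +i* a :> R[i] by simpc.
  rewrite (qZc (- b) a) -[_ *: (_ -i* _)]/((a +i* b) * _).
  by simpc; apply/eqP; rewrite eq_complex /=; apply/andP; split; apply/eqP; ring.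
have Ref y : complex.Re (f y) = q y by rewrite fE.
have f_le y : `|f y| <= `|y|.
  have [->|fy0] := eqVneq (f y) 0; first by rewrite normr0.
  have n0 : `|f y| != 0 by rewrite normr_eq0.
  pose c : R[i] := (f y)^* / `|f y|.
  have c1 : `|c| = 1 by rewrite normrM normfV normr_id normcJ divff.
  have fc : f (c *: y) = `|f y|.
    rewrite linearZ /= /GRing.scale/= /c mulrAC [_^* * _]mulrC -sqr_normc.
    by rewrite expr2 mulfK.
  have := qp (c *: y); rewrite -Ref fc -lecR pE RRe_real ?normr_real//.
  by rewrite normrZ c1 mul1r.
exists f; split=> //; apply/eqP; rewrite eq_le f_le/=.
rewrite -pE -qx -Ref; apply: le_trans (normc_ge_Re _).
by rewrite lecR ler_norm.
Qed.

Lemma rat_dense (R : realType) (c e : R) : 0 < e ->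
  exists a : rat, `|c - ratr a| < e.
Proof.
move=> e0; have [a] := @rat_in_itvoo R (c - e) (c + e) ltac:(lra).
rewrite in_itv/= => /andP[h1 h2]; exists a.
by rewrite ltr_norml; apply/andP; split; lra.
Qed.

Lemma real_dense_sequence (R : realType) : has_dense_sequence R.
Proof.
exists (fun n => ratr (odflt 0 (unpickle n))) => c e e0.
by have [a ca] := rat_dense c e0; exists (pickle a); rewrite pickleK.
Qed.

Lemma complex_dense_sequence (R : realType) : has_dense_sequence R[i].
Proof.
pose q n : R[i] := let ab : rat * rat := odflt (0, 0) (unpickle n) in
  (ratr ab.1) +i* (ratr ab.2).
exists q => -[a b] [e e'] /[!ltcE]/= /andP[/eqP e'0 e0].
have e2 : 0 < e / 2 by lra.
have [a' aa'] := rat_dense a e2; have [b' bb'] := rat_dense b e2.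
exists (pickle (a', b')); rewrite /q pickleK/=.
rewrite -[e +i* e']/(Complex e e') e'0 -[Complex e 0]/(e%:C).
have -> : (a +i* b - ratr a' +i* ratr b' : R[i]) =
    (a - ratr a')%:C + 'i * (b - ratr b')%:C by simpc.
apply: le_lt_trans (ler_normD _ _) _.
rewrite normrM.
have -> : `|'i%C : R[i]| = 1 by rewrite normc_def/= expr0n expr1n add0r sqrtr1.
have nC (r : R) : `|r%:C| = `|r|%:C :> R[i].
  by rewrite normc_def/= expr0n addr0 sqrtr_sqr.
by rewrite mul1r !nC -rmorphD ltcR; lra.
Qed.

Lemma real_vanishing_halves (R : realType) : vanishing_halves R.
Proof.
move=> e e0; exists (Num.truncn e^-1).+1.
rewrite exprVn -[ltRHS]invrK ltf_pV2 ?posrE ?invr_gt0 ?exprn_gt0//.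
apply: lt_trans (truncnS_gt _) _.
by rewrite -natrX ltr_nat ltn_expl.
Qed.

Lemma complex_vanishing_halves (R : realType) : vanishing_halves R[i].
Proof.
move=> [e e'] /[!ltcE]/= /andP[/eqP e'0 e0].
have [n ne] := real_vanishing_halves e0; exists n.
rewrite e'0 -[e +i* 0]/(e%:C).
have -> : (2^-1 ^+ n : R[i]) = (2^-1 ^+ n : R)%:C.
  by rewrite rmorphXn/= fmorphV rmorph_nat.
by rewrite ltcR.
Qed.

(** * Finitely many functionals and triangular systems *)

Section FinitelyManyFunctionals.
Variables (K : numFieldType) (X : normedModType K).

(** By induction on the number of functionals: adding [f n] either leaves the
    common kernel unchanged or cuts off from it one line, spanned by some [v]
    with [f n v != 0]. *)
Lemma kernel_finite_codimension (f : nat -> {linear X -> K^o}) n :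
  exists m (b : nat -> X), forall x, exists c : nat -> K,
    forall i, (i < n)%N -> f i (x - \sum_(j < m) c j *: b j) = 0.
Proof.
elim: n => [|n [m [b hb]]]; first by exists 0, (fun=> 0) => x; exists (fun=> 0).
have [[v [fv fnv]]|nv] := pselect
    (exists v, (forall i, (i < n)%N -> f i v = 0) /\ f n v != 0); last first.
  exists m, b => x; have [c hc] := hb x; exists c => i.
  rewrite ltnS leq_eqVlt => /predU1P[->|/hc//].
  by apply: contra_notP nv => /eqP ?; exists (x - \sum_(j < m) c j *: b j).
exists m.+1, (fun j => if j == m then v else b j) => x.
have [c hc] := hb x; set r := x - _ in hc.
exists (fun j => if j == m then f n r / f n v else c j) => i.
rewrite big_ord_recr /= eqxx.
rewrite (eq_bigr (fun j : 'I_m => c j *: b j)); last first.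
  by move=> j _; rewrite ltn_eqF.
rewrite opprD addrA -/r linearB linearZ ltnS leq_eqVlt => /predU1P[->|lt_in] /=.
  by rewrite /GRing.scale /= divfK// subrr.
by rewrite (hc i)// (fv i)// scaler0 subr0.
Qed.

Lemma unit_vector_in_kernel (f : nat -> {linear X -> K^o}) n :
  infinite_dimensional [set: X] ->
  exists x, `|x| = 1 /\ forall i, (i < n)%N -> f i x = 0.
Proof.
move=> Xinf.
have [x [x0 fx]] : exists x, x != 0 /\ forall i, (i < n)%N -> f i x = 0.
  apply: contra_notP Xinf => Nx.
  have [m [b hb]] := kernel_finite_codimension f n.
  exists m, (fun i => b i); split=> // x _; have [c hc] := hb x.
  exists (fun i => c i); apply: contra_notP Nx => xb.
  exists (x - \sum_(j < m) c j *: b j); split=> //.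
  by rewrite subr_eq0; apply/eqP.
exists (`|x|^-1 *: x); split.
  by rewrite normrZ normfV normr_id mulVf ?normr_eq0.
by move=> i /fx fix0; rewrite linearZ /= fix0 scaler0.
Qed.

(** Each new vector is taken in the common kernel of the functionals chosen
    before it, and each new functional norms the new vector.  The recursion goes
    through the list of the functionals already chosen. *)
Lemma triangular_system : norming_functionals K ->
  infinite_dimensional [set: X] ->
  exists (e : nat -> X) (g : nat -> {linear X -> K^o}), forall n,
    [/\ `|e n| = 1, forall y, `|g n y| <= `|y|, `|g n (e n)| = 1
      & forall m, (m < n)%N -> g m (e n) = 0].
Proof.
move=> HB Xinf; pose z0 : {linear X -> K^o} := \0.
have step (s : seq {linear X -> K^o}) : exists eg : X * {linear X -> K^o},
    [/\ `|eg.1| = 1, forall y, `|eg.2 y| <= `|y|, `|eg.2 eg.1| = 1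
      & forall m, (m < size s)%N -> nth z0 s m eg.1 = 0].
  have [e [e1 he]] := unit_vector_in_kernel (nth z0 s) (size s) Xinf.
  by have [g [gle ge]] := HB X e; exists (e, g); rewrite /= ge.
have [F hF] := choice step.
pose S := fix S n := if n is n'.+1 then rcons (S n') (F (S n')).2 else [::].
have sizeS n : size (S n) = n by elim: n => //= n IH; rewrite size_rcons IH.
have nthS n m : (m < n)%N -> nth z0 (S n) m = (F (S m)).2.
  elim: n => //= n IH; rewrite nth_rcons sizeS ltnS leq_eqVlt.
  by case/predU1P => [->|lt_mn]; rewrite ?ltnn ?eqxx// lt_mn IH.
exists (fun n => (F (S n)).1), (fun n => (F (S n)).2) => n.
have [h1 h2 h3 h4] := hF (S n); split=> // m lt_mn.
by rewrite -(nthS n)// h4// sizeS.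
Qed.

(** If [n] vectors spanned [Y], the invertible triangular matrix of the
    [g k (e i)] for [k, i <= n] would factor through dimension [n]. *)
Lemma infinite_dimensional_triangular (e : nat -> X)
    (g : nat -> {linear X -> K^o}) (Y : set X) :
  (forall n, Y (e n)) -> (forall n, g n (e n) != 0) ->
  (forall m n, (m < n)%N -> g m (e n) = 0) -> infinite_dimensional Y.
Proof.
move=> Ye gee ge [n [b [_ hb]]].
have [c hc] := choice (fun i => hb _ (Ye i)).
pose G : 'M[K]_n.+1 := \matrix_(k, i) g k (e i).
pose A : 'M[K]_(n.+1, n) := \matrix_(k, j) g k (b j).
pose B : 'M[K]_(n, n.+1) := \matrix_(j, i) c i j.
have GAB : G = A *m B.
  apply/matrixP => k i; rewrite !mxE {1}hc linear_sum; apply: eq_bigr => j _.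
  by rewrite linearZ !mxE mulrC.
have Gu : G \in unitmx.
  rewrite unitmxE det_trig.
    by rewrite unitfE; apply/prodf_neq0 => i _; rewrite mxE.
  by apply/is_trig_mxP => k i lt_ki; rewrite mxE ge.
have : A *m (B *m invmx G) = 1%:M by rewrite mulmxA -GAB mulmxV.
by move/mulmx1_min; rewrite ltnn.
Qed.

End FinitelyManyFunctionals.

(** * Estimates and limits over an abstract scalar field *)

Section SmallQuantities.
Variables (K : numFieldType) (X : normedModType K).

Lemma ler_add_small (a b : K) : a \is Num.real -> b \is Num.real ->
  (forall e, 0 < e -> a <= b + e) -> a <= b.
Proof.
move=> aR bR h; rewrite real_leNgt//; apply/negP => ba.
have ab0 : 0 < (a - b) / 2 by rewrite divr_gt0 ?subr_gt0.
have := h _ ab0; rewrite -lerBlDl {1}[a - b]splitr gerDl.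
by move=> /(lt_le_trans ab0); rewrite ltxx.
Qed.

Lemma norm_eq0_small (x : X) : (forall e, 0 < e -> `|x| <= e) -> x = 0.
Proof.
move=> h; apply/eqP; rewrite -normr_eq0 eq_le normr_ge0 andbT.
by apply: ler_add_small => [||e /h]; rewrite ?normr_real ?real0 ?add0r.
Qed.

Hypothesis halves : vanishing_halves K.

Lemma halves_lt (C e : K) : 0 <= C -> 0 < e -> exists n, C * 2^-1 ^+ n < e.
Proof.
move=> C0 e0; have C1 : 0 < C + 1 by rewrite ltr_wpDl.
have [n ne] := halves (divr_gt0 e0 C1); exists n.
apply: le_lt_trans (_ : (C + 1) * 2^-1 ^+ n < e).
  by rewrite ler_wpM2r ?exprn_ge0 ?invr_ge0// lerDl.
by rewrite mulrC -ltr_pdivlMr.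
Qed.

Lemma norm_eq0_halves (x : X) (C : K) N :
  (forall n, (N <= n)%N -> `|x| <= C * 2^-1 ^+ n) -> x = 0.
Proof.
move=> h.
have C0 : 0 <= C.
  have := le_trans (normr_ge0 x) (h N (leqnn _)).
  by rewrite pmulr_lge0// exprn_gt0// invr_gt0.
apply: norm_eq0_small => e e0; have [n ne] := halves_lt C0 e0.
apply: le_trans (h (maxn N n) (leq_maxl _ _)) _; apply: le_trans (ltW ne).
by rewrite ler_wpM2l// ler_wiXn2l ?leq_maxr ?invr_ge0// invf_le1 ?ler1n.
Qed.

End SmallQuantities.

Section GeometricLimit.
Variables (K : numFieldType) (X : completeNormedModType K).
Hypothesis halves : vanishing_halves K.

Lemma geometric_limit (u : nat -> X) (C : K) :
  (forall n, `|u n.+1 - u n| <= C * 2^-1 ^+ n) ->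
  exists l, forall n, `|l - u n| <= C * 2 * 2^-1 ^+ n.
Proof.
move=> uC.
have C0 : 0 <= C by have := le_trans (normr_ge0 _) (uC 0); rewrite expr0 mulr1.
(* The exact geometric tail, which makes the induction close. *)
have tail n k : `|u (n + k)%N - u n| <= C * 2 * (2^-1 ^+ n - 2^-1 ^+ (n + k)).
  elim: k => [|k IH]; first by rewrite addn0 !subrr mulr0 normr0.
  have -> : u (n + k.+1)%N - u n = u (n + k).+1 - u (n + k)%N + (u (n + k)%N - u n).
    by rewrite addnS addrA subrK.
  apply: le_trans (ler_normD _ _) _; apply: le_trans (lerD (uC _) IH) _.
  by rewrite addnS exprS le_eqVlt; apply/orP; left; apply/eqP; field.
have dist n m : (n <= m)%N -> `|u m - u n| <= C * 2 * 2^-1 ^+ n.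
  move=> /subnKC <-; apply: le_trans (tail _ _) _.
  by rewrite ler_wpM2l ?mulr_ge0// gerDl oppr_le0 exprn_ge0// invr_ge0.
have cu : cvg (u @ \oo).
  apply: cauchy_cvg; apply: cauchy_exP => e e0.
  have [n ne] := halves_lt halves (mulr_ge0 C0 (ler0n _ 2)) e0.
  exists (u n), n => // m /= /dist le_nm.
  by rewrite /= -ball_normE /ball_ /= distrC; apply: le_lt_trans ne.
exists (lim (u @ \oo)) => n; apply: ler_add_small; first exact: normr_real.
  by rewrite !realM ?ger0_real// ?exprn_ge0// ?invr_ge0.
move=> e e0; have /cvgrPdist_lt/(_ e e0)[N _ hN] := cu.
have /hN/ltW he : (N <= maxn n N)%N by apply: leq_maxr.
have -> : lim (u @ \oo) - u n = (u (maxn n N) - u n) +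
    (lim (u @ \oo) - u (maxn n N)).
  by rewrite [RHS]addrC addrA subrK.
apply: le_trans (ler_normD _ _) _.
by rewrite lerD// dist// leq_maxl.
Qed.

End GeometricLimit.

(** * Norming sequences *)

Section NormingSequence.
Variables (K : numFieldType) (X : normedModType K).

(** With [f n] norming [q n], if [q n] is close to [y] then [`|y|] is close to
    [`|f n y| = `|f n (y + z)|]. *)
Lemma norming_sequence (HB : norming_functionals K) (q : nat -> X) :
  exists f : nat -> {linear X -> K^o}, (forall n y, `|f n y| <= `|y|) /\
  forall y z, (forall e, 0 < e -> exists n, `|y - q n| < e) ->
    (forall n, f n z = 0) -> `|y| <= `|y + z|.
Proof.
have [f hf] := choice (fun n => HB X (q n)); exists f.
split=> [n|y z yq fz]; first exact: (hf n).1.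
apply: ler_add_small => [||e e0]; rewrite ?normr_real//.
have [n yn] := yq (e / 2) (divr_gt0 e0 (ltr0n _ 2)).
have [fle fq] := hf n.
apply: (@le_trans _ _ (`|q n| + `|y - q n|)).
  by rewrite -{1}(subrK (q n) y) addrC ler_normD.
have -> : `|y + z| + e = `|y + z| + e / 2 + e / 2 by field.
apply: lerD (ltW yn).
rewrite -fq.
have -> : f n (q n) = f n (y + z) - f n (y - q n).
  by rewrite linearD linearB fz addr0 opprB addrC subrK.
apply: le_trans (ler_normB _ _) _.
by rewrite lerD// (le_trans (fle _))// ltW.
Qed.

(** The combinations with coefficients in a dense sequence of scalars are indexed
    by the finite lists of indices, of which there are countably many. *)
Lemma dense_sequence_in_span (dK : has_dense_sequence K) (e : nat -> X) :
  exists q : nat -> X, forall m (c : nat -> K) d, 0 < d ->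
    exists n, `|\sum_(i < m) c i *: e i - q n| < d.
Proof.
have [r hr] := dK.
pose comb (s : seq nat) := \sum_(i < size s) r (nth 0 s i) *: e i.
exists (fun n => comb (odflt [::] (unpickle n))) => m c d d0.
suff [s [_ hs]] : exists s, size s = m /\ `|\sum_(i < m) c i *: e i - comb s| < d.
  by exists (pickle s); rewrite pickleK.
elim: m d d0 => [|m IH] d d0.
  by exists [::]; rewrite /comb !big_ord0 subrr normr0.
have d2 : 0 < d / 2 by rewrite divr_gt0.
have [s [sm hs]] := IH _ d2; subst m.
have e1 : 0 < `|e (size s)| + 1 by rewrite ltr_wpDl.
have [k hk] := hr (c (size s)) _ (divr_gt0 d2 e1).
exists (rcons s k); rewrite size_rcons; split=> //.
rewrite /comb size_rcons !big_ord_recr /= nth_rcons ltnn eqxx.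
rewrite [X in _ - (X + _)](eq_bigr
  (fun i : 'I_(size s) => r (nth 0 s i) *: e i)); last first.
  by move=> i _; rewrite nth_rcons ltn_ord.
rewrite opprD addrACA -scalerBl [d](splitr d).
apply: le_lt_trans (ler_normD _ _) _; apply: ltrD; first exact: hs.
rewrite normrZ.
apply: le_lt_trans (_ : `|c (size s) - r k| * (`|e (size s)| + 1) < _).
  by rewrite ler_wpM2l// lerDl.
by rewrite -ltr_pdivlMr.
Qed.

End NormingSequence.

(** * The diagonal operator *)

Definition has_injective_nonautomorphism (K : numFieldType)
    (X : normedModType K) :=
  exists T : {linear X -> X},
    [/\ bounded_operator T, injective T & ~ automorphism T].

Section Diagonal.
Variables (K : numFieldType) (X : completeNormedModType K).
Hypothesis halves : vanishing_halves K.
Variables (e : nat -> X) (f : nat -> {linear X -> K^o}).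
Hypothesis e1 : forall n, `|e n| = 1.
Hypothesis f_le : forall n y, `|f n y| <= `|y|.

Definition diagonal_sum n x : X := \sum_(i < n) (2^-1 ^+ i * f i x) *: e i.

Lemma diagonal_sum_linear n : linear (diagonal_sum n).
Proof.
move=> a x y; rewrite /diagonal_sum scaler_sumr -big_split; apply: eq_bigr => i _.
by rewrite /= linearP /= scalerA -scalerDl mulrDr mulrCA.
Qed.

(** The convergence estimate is part of the conclusion, since boundedness,
    injectivity and the failure of invertibility are all read off from it. *)
Lemma diagonal_operator : exists T : {linear X -> X},
  forall n x, `|T x - diagonal_sum n x| <= `|x| * 2 * 2^-1 ^+ n.
Proof.
have lim_ex x : exists l, forall n, `|l - diagonal_sum n x| <= `|x| * 2 * 2^-1 ^+ n.
  apply: geometric_limit => // n.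
  rewrite /diagonal_sum big_ord_recr /= addrAC subrr add0r normrZ e1 mulr1.
  rewrite normrM normrX normfV normr_nat mulrC.
  by rewrite ler_wpM2r// exprn_ge0// invr_ge0.
have [T0 hT0] := choice lim_ex.
have [|T TE] := @bundle_linear _ X X T0; last by exists T => n x; rewrite TE.
move=> a x y; apply/eqP; rewrite -subr_eq0; apply/eqP.
apply: (@norm_eq0_halves _ _ halves _
  ((`|a *: x + y| + `|a| * `|x| + `|y|) * 2) 0) => n _.
have -> : T0 (a *: x + y) - (a *: T0 x + T0 y) =
    (T0 (a *: x + y) - diagonal_sum n (a *: x + y))
    - (a *: (T0 x - diagonal_sum n x) + (T0 y - diagonal_sum n y)).
  rewrite diagonal_sum_linear scalerBr addrACA -opprD [in RHS]opprB.
  by rewrite addrA subrK.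
apply: le_trans (ler_normB _ _) _.
rewrite -addrA !mulrDl; apply: lerD; first exact: hT0.
apply: le_trans (ler_normD _ _) _; apply: lerD; last exact: hT0.
by rewrite normrZ -!mulrA ler_wpM2l// !mulrA hT0.
Qed.

End Diagonal.

Section Operator.
Variables (K : numFieldType) (X : completeNormedModType K).
Hypothesis halves : vanishing_halves K.

(** The diagonal operator with a triangular system [e], [g] does the job: [g]
    recovers the values [f n x] from [T x] one after the other, while the weights
    [2^-n] make [T] small on the common kernel of many of the [f n]. *)
Lemma operator_of_separating_sequence (HB : norming_functionals K)
    (Xinf : infinite_dimensional [set: X]) (f : nat -> {linear X -> K^o}) :
  (forall n y, `|f n y| <= `|y|) -> (forall x, (forall n, f n x = 0) -> x = 0) ->
  has_injective_nonautomorphism X.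
Proof.
move=> f_le f_sep; have [e [g eg]] := triangular_system HB Xinf.
have e1 n : `|e n| = 1 by have [] := eg n.
have [T hT] := diagonal_operator halves e1 f_le; exists T; split.
- exists 2 => x; have := hT 0 x.
  by rewrite /diagonal_sum big_ord0 subr0 expr0 mulr1 mulrC.
- suff ker x : T x = 0 -> x = 0.
    move=> x y Txy; apply/eqP; rewrite -subr_eq0; apply/eqP/ker.
    by rewrite linearB /= Txy subrr.
  move=> Tx0; apply: f_sep => n; elim/ltn_ind: n => m IH.
  have [_ gle gme _] := eg m.
  (* The terms before [m] vanish by induction, the terms after [m] because the
     system is triangular. *)
  have sumE n : (m < n)%N ->
      g m (diagonal_sum e f n x) = 2^-1 ^+ m * f m x * g m (e m).
    move=> lt_mn; rewrite /diagonal_sum linear_sum (bigD1 (Ordinal lt_mn)) //=.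
    rewrite linearZ big1 ?addr0// => i ne_im; rewrite linearZ /=.
    have [lt_im|lt_mi|eq_im] := ltngtP (i : nat) m.
    + by rewrite IH// mulr0 scale0r.
    + by have [_ _ _ /(_ _ lt_mi) ->] := eg i; rewrite scaler0.
    + by case/eqP: ne_im; apply: val_inj.
  have : 2^-1 ^+ m * f m x * g m (e m) = 0 :> K^o.
    apply: (@norm_eq0_halves _ K^o halves _ (`|x| * 2) m.+1) => n lt_mn.
    rewrite -(sumE n)//; apply: le_trans (gle _) _.
    by have := hT n x; rewrite Tx0 sub0r normrN.
  move=> /eqP; rewrite !mulf_eq0 expf_eq0 invr_eq0 pnatr_eq0 andbF /=.
  move=> /orP[/eqP//|/eqP gme0]; move: gme.
  by rewrite gme0 normr0 => /esym/eqP; rewrite oner_eq0.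
- (* An inverse bounded by [M] would give [1 <= M * 2 * 2^-n] for every [n], by
     evaluation at a unit vector killed by the first [n] functionals. *)
  case=> _ [S [[M SM] SK _]].
  suff : (1 : K^o) = 0 by move=> /eqP; rewrite oner_eq0.
  apply: (@norm_eq0_halves _ K^o halves _ (M * 2) 0) => n _.
  have [x [x1 fx]] := unit_vector_in_kernel f n Xinf.
  have M0 : 0 <= M by have := le_trans (normr_ge0 _) (SM x); rewrite x1 mulr1.
  have := SM (T x); rewrite SK x1 normr1 => /le_trans; apply.
  rewrite -mulrA ler_wpM2l//; have := hT n x.
  rewrite /diagonal_sum big1 ?subr0 ?x1 ?mul1r// => i _.
  by rewrite fx// mulr0 scale0r.
Qed.

End Operator.

(** * Closed spans and direct sums *)

Section Closure.
Variables (K : numFieldType) (X : normedModType K).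

Lemma closure_normP (A : set X) (x : X) :
  closure A x <-> forall d, 0 < d -> exists a, A a /\ `|x - a| < d.
Proof.
split=> [Ax d d0|Ax B /nbhs_normP[d /= d0 dB]].
  have [a [Aa ad]] := Ax _ (nbhsx_ballx x d d0).
  by exists a; split=> //; rewrite -ball_normE in ad.
by have [a [Aa xa]] := Ax d d0; exists a; split=> //; apply: dB.
Qed.

Definition seq_span (e : nat -> X) : set X :=
  [set x | exists m (c : nat -> K), x = \sum_(i < m) c i *: e i].

Lemma mem_seq_span (e : nat -> X) n : seq_span e (e n).
Proof.
exists n.+1, (fun i => (i == n)%:R).
rewrite big_ord_recr /= eqxx scale1r big1 ?add0r// => i _.
by rewrite ltn_eqF// scale0r.
Qed.

Lemma seq_span_linear (e : nat -> X) a x y :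
  seq_span e x -> seq_span e y -> seq_span e (a *: x + y).
Proof.
have widen m k (c : nat -> K) : (m <= k)%N -> \sum_(i < m) c i *: e i =
    \sum_(i < k) (if (i < m)%N then c i else 0) *: e i.
  move=> mk; rewrite (big_ord_widen k (fun i => c i *: e i) mk) big_mkcond /=.
  by apply: eq_bigr => i _; case: ifP; rewrite ?scale0r.
move=> [m [c ->]] [n [d ->]].
rewrite (widen _ _ _ (leq_maxl m n)) (widen _ _ d (leq_maxr m n)).
rewrite scaler_sumr -big_split /=; exists (maxn m n).
exists (fun i => a * (if (i < m)%N then c i else 0) + if (i < n)%N then d i else 0).
by apply: eq_bigr => i _; rewrite scalerA -scalerDl.
Qed.

Lemma closed_span_subspace (e : nat -> X) : closed_subspace (closure (seq_span e)).
Proof.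
split; last exact: closed_closure.
split=> [|a x y]; rewrite !inE.
  by apply: subset_closure; exists 0, (fun=> 0); rewrite big_ord0.
move=> /closure_normP hx /closure_normP hy; apply/closure_normP => d d0.
have d2 : 0 < d / 2 by rewrite divr_gt0.
have a1 : 0 < `|a| + 1 by rewrite ltr_wpDl.
have [x' [Ex xx']] := hx _ (divr_gt0 d2 a1); have [y' [Ey yy']] := hy _ d2.
exists (a *: x' + y'); split; first exact: seq_span_linear.
rewrite opprD addrACA -scalerBr [d]splitr.
apply: le_lt_trans (ler_normD _ _) _; apply: ltrD => //; rewrite normrZ.
apply: le_lt_trans (_ : (`|a| + 1) * `|x - x'| < _).
  by rewrite ler_wpM2r// lerDl.
by rewrite mulrC -ltr_pdivlMr.
Qed.

Lemma closed_span_dense_sequence (dK : has_dense_sequence K) (e : nat -> X) :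
  exists q : nat -> X, forall y, closure (seq_span e) y ->
    forall d, 0 < d -> exists n, `|y - q n| < d.
Proof.
have [q hq] := dense_sequence_in_span dK e; exists q => y /closure_normP hy d d0.
have d2 : 0 < d / 2 by rewrite divr_gt0.
have [x [[m [c ->]] yx]] := hy _ d2; have [n xn] := hq m c _ d2; exists n.
rewrite -(subrK (\sum_(i < m) c i *: e i) y) -addrA [d]splitr.
by apply: le_lt_trans (ler_normD _ _) _; apply: ltrD.
Qed.

Lemma common_kernel_subspace (f : nat -> {linear X -> K^o}) :
  (forall n y, `|f n y| <= `|y|) ->
  closed_subspace [set w | forall n, f n w = 0].
Proof.
move=> f_le; split.
  split=> [|a x y]; rewrite !inE /=; first by move=> n; rewrite linear0.
  by move=> fx fy n; rewrite linearP fx fy scaler0 addr0.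
move=> z /closure_normP hz n; apply: norm_eq0_small => d d0.
have [w [fw zw]] := hz d d0.
rewrite -[f n z]subr0 -(fw n) -linearB; apply: le_trans (f_le _ _) (ltW zw).
Qed.

End Closure.

Lemma countable_enumeration (T : Type) (D : set T) (d0 : T) : D d0 -> countable D ->
  exists q : nat -> T, (forall n, D (q n)) /\ forall d, D d -> exists n, q n = d.
Proof.
move=> Dd0 /countable_injP[h hinj].
have ex n : exists d, D d /\ ((exists d', D d' /\ h d' = n) -> h d = n).
  have [[d [Dd hd]]|N] := pselect (exists d, D d /\ h d = n); first by exists d.
  by exists d0.
have [q hq] := choice ex; exists q; split=> [n|d Dd]; first exact: (hq n).1.
exists (h d); apply: hinj; rewrite ?inE//; first exact: (hq _).1.
by apply: (hq (h d)).2; exists d.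
Qed.

Section DirectSum.
Variables (K : numFieldType) (X : completeNormedModType K).
Hypothesis halves : vanishing_halves K.

(** The inequality bounds the projection onto [Y] along [W] by 1.  The sum is
    therefore closed: if [y_n + w_n] converges to [z] fast enough, the [y_n] have
    a limit [l] in [Y], and [z - l] lies in [W]. *)
Lemma norming_direct_sum (Y : set X) (f : nat -> {linear X -> K^o}) :
  closed_subspace Y -> (forall n y, `|f n y| <= `|y|) ->
  (forall y z, Y y -> (forall n, f n z = 0) -> `|y| <= `|y + z|) ->
  let W := [set w | forall n, f n w = 0] in
  let Z := [set y + w | y in Y & w in W] in
  closed_subspace Z /\ topological_direct_sum Z Y W.
Proof.
move=> [[Y0 Ylin] Ycl] f_le hY W Z.
have [[W0 Wlin] _] := common_kernel_subspace f_le.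
rewrite !inE in Y0 W0.
have YB y y' : Y y -> Y y' -> Y (y' - y).
  move=> Yy Yy'; have := Ylin (-1) y y'; rewrite !inE scaleN1r addrC.
  exact.
have WB y y' : W y -> W y' -> W (y' - y).
  by move=> Wy Wy' n; rewrite linearB Wy Wy' subrr.
split; last first.
  split=> //.
    apply/seteqP; split=> [y [Yy Wy]|_ ->] /=; last by split.
    have := hY y (- y) Yy; rewrite subrr normr0 normr_le0.
    by move=> h; apply/eqP/h => n; rewrite linearN Wy oppr0.
  exists 3 => y w Yy Ww.
  have yw := hY _ _ Yy Ww.
  have -> : 3 * `|y + w| = `|y + w| + (`|y + w| + `|y + w|) by ring.
  apply: lerD => //.
  apply: (@le_trans _ _ (`|y + w| + `|y|)); last by rewrite lerD2l.
  by rewrite -{1}(addKr y w) addrC ler_normB.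
split.
  split=> [|a x x']; rewrite !inE /=.
    by exists 0 => //; exists 0 => //; rewrite addr0.
  move=> [y Yy [w Ww <-]] [y' Yy' [w' Ww' <-]].
  exists (a *: y + y'); first by have := Ylin a y y'; rewrite !inE; apply.
  exists (a *: w + w'); first by have := Wlin a w w'; rewrite !inE; apply.
  by rewrite scalerDr addrACA.
move=> z /closure_normP hz.
have h0 n : 0 < 2^-1 ^+ n :> K by rewrite exprn_gt0// invr_gt0.
have approx n : exists yw : X * X,
    [/\ Y yw.1, W yw.2 & `|z - (yw.1 + yw.2)| <= 2^-1 ^+ n].
  have [_ [[y Yy [w Ww <-]] /ltW zyw]] := hz _ (h0 n).
  by exists (y, w).
have [yw hyw] := choice approx.
have step n : `|(yw n.+1).1 - (yw n).1| <= 2 * 2^-1 ^+ n.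
  have [Y1 W1 z1] := hyw n; have [Y2 W2 z2] := hyw n.+1.
  apply: le_trans (hY _ _ (YB _ _ Y1 Y2) (WB _ _ W1 W2)) _.
  rewrite addrACA -opprD -(subrKA z); apply: le_trans (ler_normD _ _) _.
  rewrite [2 * _]mulr_natl mulr2n; apply: lerD => //.
  rewrite distrC; apply: le_trans z2 _.
  by rewrite exprS ger_pMl// invf_le1// ler1n.
have [l hl] := geometric_limit halves step.
have Yl : Y l.
  apply: Ycl; apply/closure_normP => d d0.
  have [n nd] := halves_lt halves (ler0n K 4) d0.
  exists (yw n).1; split; first by have [] := hyw n.
  by apply: le_lt_trans nd; apply: le_trans (hl n) _; rewrite -natrM.
exists l => //; exists (z - l); last by rewrite addrC subrK.
(* The constant is 1 for the distance from [z] to [y_n + w_n], plus 2 * 2 for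
   the distance from [l] to [y_n]. *)
move=> k; apply: (@norm_eq0_halves _ K^o halves _ 5 0) => n _.
have [_ Wn zn] := hyw n.
have -> : f k (z - l) = f k ((z - ((yw n).1 + (yw n).2)) - (l - (yw n).1)).
  rewrite opprD addrA opprB.
  have -> : z - (yw n).1 - (yw n).2 + ((yw n).1 - l) = z - l - (yw n).2.
    by rewrite addrAC addrA subrK.
  by rewrite [RHS]linearB Wn subr0.
apply: le_trans (f_le _ _) _; apply: le_trans (ler_normB _ _) _.
apply: le_trans (lerD zn (hl n)) _.
by rewrite -{1}[2^-1 ^+ n]mul1r -mulrDl -natrM -(natrD _ 1).
Qed.

End DirectSum.

(** * Spaces with separating sequences of functionals *)

Section SeparatingSequences.
Variables (K : numFieldType) (X : completeNormedModType K).
Hypothesis HB : norming_functionals K.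
Hypothesis dK : has_dense_sequence K.
Hypothesis halves : vanishing_halves K.

(** For [x != 0] the functionals that do not vanish at [x] form a weak* open set
    which meets the dual ball by Hahn-Banach, hence meets its dense subset. *)
Lemma weak_star_separable_operator : infinite_dimensional [set: X] ->
  separable_set (@dual_ball K X) -> has_injective_nonautomorphism X.
Proof.
move=> Xinf [D [Dc Dball Ddense]].
have ball (f : {linear X -> K^o}) : (forall y, `|f y| <= `|y|) ->
    dual_ball (f : {ptws X -> K^o}).
  move=> f_le; split; last by move=> y; apply: le_trans.
  by split; [exact: linearP|exists 1 => y; rewrite mul1r].
have sep x : x != 0 -> exists f : {ptws X -> K^o}, D f /\ f x != 0.
  move=> x0; have [f [f_le fx]] := @HB X x.
  have fx0 : f x != 0 by rewrite -normr_eq0 fx normr_eq0.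
  have /Ddense := ball f f_le.
  move=> /(_ [set g | g x != 0]) [|g [Dg gx]]; last by exists g.
  have := @proj_continuous X (fun=> K^o) x (f : {ptws X -> K^o}).
  move=> /(_ [set t | t != 0]); apply.
  apply/nbhs_normP; exists `|f x| => /=; first by rewrite normr_gt0.
  by move=> t /=; apply: contraTneq => ->; rewrite subr0 ltxx.
have [d0 Dd0] : exists d0, D d0.
  have := @unit_vector_in_kernel _ X (fun=> \0) 0 Xinf.
  move=> [x [x1 _]]; have [|f [Df _]] := sep x; last by exists f.
  by rewrite -normr_eq0 x1 oner_eq0.
have [q [Dq Dq']] := countable_enumeration Dd0 Dc.
have qlin n : exists f : {linear X -> K^o}, f =1 q n.
  by apply: (@bundle_linear _ X K^o); have [[]] := Dball _ (Dq n).
have [f fE] := choice qlin.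
apply: (operator_of_separating_sequence halves HB Xinf (f := f)) => [n y|x fx].
  have [->|y0] := eqVneq y 0; first by rewrite linear0 !normr0.
  have [_ qle] := Dball _ (Dq n).
  have yn0 : 0 < `|y| by rewrite normr_gt0.
  have := qle (`|y|^-1 *: y).
  rewrite -fE linearZ /= !normrZ normfV normr_id mulVf ?gt_eqF// => /(_ (lexx _)).
  by rewrite ler_pdivrMl// mulr1.
apply/eqP/contraT => /sep[g [/Dq'[n <-]]].
by rewrite -fE fx eqxx.
Qed.

(** Applying the norming inequality to [y = x] and [z = - x] shows that a norming
    sequence for a dense sequence separates points. *)
Lemma separable_operator : infinite_dimensional [set: X] ->
  separable_set [set: X] -> has_injective_nonautomorphism X.
Proof.
move=> Xinf [D [Dc _ Ddense]].
have [d0 [Dd0 _]] := (closure_normP D 0).1 (Ddense 0 I) 1 ltr01.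
have [q [_ qD]] := countable_enumeration Dd0 Dc.
have [f [f_le fq]] := norming_sequence HB q.
apply: (operator_of_separating_sequence halves HB Xinf f_le) => x fx.
apply/eqP; rewrite -normr_le0 -(normr0 X) -(subrr x).
apply: fq => [d dpos|n]; last by rewrite linearN fx oppr0.
have [_ [/qD[n <-] xq]] := (closure_normP D x).1 (Ddense x I) d dpos.
by exists n.
Qed.

(** The functionals norming the closed span [Y] of a triangular system may vanish
    jointly on a subspace [W] complementing [Y], but indecomposability makes [W]
    finite dimensional, hence spanned by a sequence, and its points are separated
    by one more norming sequence. *)
Lemma hereditarily_indecomposable_operator :
  hereditarily_indecomposable X -> has_injective_nonautomorphism X.
Proof.
move=> [Xinf HI].
have [e [g eg]] := triangular_system HB Xinf.
have [q qY] := closed_span_dense_sequence dK e.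
have [f [f_le fq]] := norming_sequence HB q.
pose Y := closure (seq_span e); pose W := [set w | forall n, f n w = 0].
have Yinf : infinite_dimensional Y.
  apply: (@infinite_dimensional_triangular _ _ e g) => [n|n|m n lt_mn].
  - exact/subset_closure/mem_seq_span.
  - by have [_ _ ge _] := eg n; rewrite -normr_eq0 ge oner_eq0.
  - by have [_ _ _ ->] := eg n.
have [n [b [_ Wb]]] : finite_dimensional W.
  apply: contrapT => Winf; apply: HI.
  have [Zcl YW] := norming_direct_sum halves (closed_span_subspace e) f_le
    (fun y z Yy => fq y z (qY y Yy)).
  exists [set y + w | y in Y & w in W], Y, W; split=> //.
  + exact: closed_span_subspace.
  + exact: common_kernel_subspace.
(* The spanning family is padded with zeros to an infinite sequence. *)
pose b' i := if insub i is Some j then b j else 0.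
have [q' q'W] := closed_span_dense_sequence dK b'.
have [f' [f'_le f'q]] := norming_sequence HB q'.
pose h k := if odd k then f' k./2 else f k./2.
apply: (operator_of_separating_sequence halves HB Xinf (f := h)) => [k y|x hx].
  by rewrite /h; case: ifP.
have Wx : W x by move=> k; have := hx k.*2; rewrite /h odd_double doubleK.
have f'x k : f' k x = 0.
  by have := hx k.*2.+1; rewrite /h /= odd_double /= uphalf_double.
apply/eqP; rewrite -normr_le0 -(normr0 X) -(subrr x).
apply: f'q => [d d0|k]; last by rewrite linearN f'x oppr0.
apply: q'W d0; apply: subset_closure.
have [c ->] := Wb x Wx.
exists n, (fun i => if insub i is Some j then c j else 0).
by apply: eq_bigr => i _; rewrite /b' valK.
Qed.

End SeparatingSequences.

(** * The theorem *)

Theorem proposition1p2 (R : realType) (K : numFieldType)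
    (realOrComplex : K = (R : numFieldType) \/ K = (R[i] : numFieldType)) :
  [/\ forall X : completeNormedModType K,
        infinite_dimensional [set: X] ->
        separable_set (@dual_ball K X) ->
        exists T : {linear X -> X},
          [/\ bounded_operator T, injective T & ~ automorphism T],
      forall X : completeNormedModType K,
        infinite_dimensional [set: X] ->
        separable_set [set: X] ->
        exists T : {linear X -> X},
          [/\ bounded_operator T, injective T & ~ automorphism T]
    & forall X : completeNormedModType K,
        hereditarily_indecomposable X ->
        exists T : {linear X -> X},
          [/\ bounded_operator T, injective T & ~ automorphism T]].
Proof.
have [HB dK halves] :
    [/\ norming_functionals K, has_dense_sequence K & vanishing_halves K].
  case: realOrComplex => ->; split.
  - exact: real_norming.
  - exact: real_dense_sequence.
  - exact: real_vanishing_halves.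
  - exact: complex_norming.
  - exact: complex_dense_sequence.
  - exact: complex_vanishing_halves.
split=> X.
- exact: weak_star_separable_operator.
- exact: separable_operator.
- exact: hereditarily_indecomposable_operator.
Qed.
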